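(* Let $B_4$ be the (weak) Bruhat graph of order 4. Then $\pi(B_4)\le 72$.
   Context: The weak Bruhat graph $B_m$ of order $m$ has as vertices all permutations of $\{1,\dots,m\}$, with two permutations adjacent when they differ by an adjacent transposition (i.e. $B_m$ is the Cayley graph of the symmetric group $S_m$ generated by the transpositions $(i\ i+1)$, $1\le i<m$). A configuration on a connected graph $G$ is a function $C:V(G)\to\mathbb{N}$; a pebbling step from $u$ to a neighbor $v$ removes two pebbles from $u$ and adds one to $v$; $C$ is $r$-solvable if some sequence of pebbling steps places a pebble on $r$. $\pi(G,r)$ is the minimum $t$ such that every configuration with $t$ pebbles in total is $r$-solvable, and $\pi(G)=\max_r\pi(G,r)$. *)

(* Defs.v *)
From mathcomp Require Import all_boot all_fingroup.
From mathcomp Require Import boolp.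

Set Implicit Arguments.
Unset Strict Implicit.
Unset Printing Implicit Defensive.

Record connectedGraph := ConnectedGraph {
  vertex :> finType;
  edge : rel vertex;
  edge_sym : symmetric edge;
  edge_irr : irreflexive edge;
  edge_connected : forall u v, connect edge u v }.

Section Pebbling.

Variable G : connectedGraph.

Definition config := {ffun G -> nat}.

Implicit Types (C D : config) (u v r : G).

Definition pebbles C : nat := \sum_(u : G) C u.

(* The natural subtraction is only used when [C u] is at least 2, see
   [pebbling_step]; since [edge] is irreflexive, [u != v] there. *)
Definition move C u v : config :=
  [ffun x => C x - (if x == u then 2 else 0) + (if x == v then 1 else 0)].

Definition pebbling_step : rel config := fun C D =>
  [exists u, exists v, [&& edge u v, 2 <= C u & D == move C u v]].

Definition solvable r C : Prop :=
  exists s : seq config, path pebbling_step C s /\ 0 < last C s r.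

Definition all_solvable r (t : nat) : Prop :=
  forall C, pebbles C = t -> solvable r C.

Lemma pebbling_stepT C u v :
  edge u v -> 2 <= C u -> pebbling_step C (move C u v).
Proof.
by move=> e2 c2; apply/existsP; exists u; apply/existsP; exists v; rewrite e2 c2 /=.
Qed.

Lemma pebbling_transfer k C u v : edge u v -> k.*2 <= C u ->
  exists s, path pebbling_step C s /\ k <= last C s v.
Proof.
move=> euv; have nuv : (v == u) = false.
  by apply/eqP=> vu; move: euv; rewrite vu edge_irr.
suff H : k.*2 <= C u ->
    exists s, path pebbling_step C s /\ k + C v <= last C s v.
  by move=> /H[s [ps ls]]; exists s; split=> //; apply: leq_trans ls; rewrite leq_addr.
elim: k C => [|k IHk] C Cu; first by exists [::].
have C2 : 2 <= C u by apply: leq_trans Cu; rewrite doubleS.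
have [|s [ps ls]] := IHk (move C u v).
  by rewrite ffunE eqxx eq_sym nuv addn0 leq_subRL // addnC addn2 -doubleS.
exists (move C u v :: s); split; first by rewrite /= pebbling_stepT.
apply: leq_trans ls; rewrite ffunE nuv eqxx subn0.
by rewrite addn1 addSnnS.
Qed.

Lemma solvable_path p u C :
  path (@edge G) u p -> 2 ^ size p <= C u -> solvable (last u p) C.
Proof.
elim: p u C => [|v p IHp] u C /=; first by exists [::].
move=> /andP[euv pp]; rewrite expnS mul2n => /(pebbling_transfer euv)[s [ps ls]].
have [s' [ps' ls']] := IHp v (last C s) pp ls.
by exists (s ++ s'); rewrite cat_path ps ps' last_cat.
Qed.

Lemma all_solvable_ex r : exists t, `[< all_solvable r t >].
Proof.
exists (#|G| * 2 ^ #|G|).+1; apply/asboolP => C Ct.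
have [u Cu] : exists u, 2 ^ #|G| <= C u.
  apply/existsP; apply: contraPT Ct => /existsPn Cs; apply/eqP.
  rewrite neq_ltn ltnS /pebbles -sum_nat_const leq_sum // => u _.
  by move: (Cs u); rewrite -ltnNge => /ltnW.
have /connectP[p pp ->] := edge_connected u r.
case: (shortenP pp) => p' pp' up' _; apply: solvable_path => //.
apply: leq_trans Cu; rewrite leq_exp2l //.
by have := max_card (mem (u :: p')); rewrite (card_uniqP up') => /ltnW.
Qed.

Definition rooted_pebbling_number r : nat := ex_minn (all_solvable_ex r).

Definition pebbling_number : nat := \max_(r : G) rooted_pebbling_number r.

End Pebbling.

Section Bruhat.

Variable m : nat.

(* Permutations of {1, ..., m} are permutations of 'I_m = {0, ..., m - 1}.  As
   [(t * s) x = s (t x)], multiplying by [t] on the left swaps the entries in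
   positions i and i + 1 of the word s(0) s(1) ... s(m - 1). *)
Definition bruhat_edge : rel 'S_m := fun s s' =>
  [exists i : 'I_m, exists j : 'I_m,
     (j == i.+1 :> nat) && (s' == (tperm i j * s)%g)].

Lemma bruhat_edge_sym : symmetric bruhat_edge.
Proof.
suff H s s' : bruhat_edge s s' -> bruhat_edge s' s by move=> s s'; apply/idP/idP; apply: H.
move=> /existsP[i /existsP[j /andP[ij /eqP->]]].
by apply/existsP; exists i; apply/existsP; exists j; rewrite ij mulgA tperm2 mul1g /=.
Qed.

Lemma bruhat_edge_irr : irreflexive bruhat_edge.
Proof.
move=> s; apply/idP => /existsP[i /existsP[j /andP[/eqP ij]]].
rewrite -{1}[s]mul1g => /eqP/mulIg/permP/(_ i); rewrite perm1 tpermL => e.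
by move: ij; rewrite -e => /n_Sn.
Qed.

Lemma bruhat_connect_tperm (i j : 'I_m) s :
  connect bruhat_edge s (tperm i j * s)%g.
Proof.
wlog ij : i j / i <= j.
  by move=> H; case: (leqP i j) => [|/ltnW] /H //; rewrite tpermC.
elim: {j}(j : nat) {-2}j (erefl (j : nat)) ij s => [|n IHn] j jn ij s.
  have -> : i = j by apply: val_inj; apply/eqP; rewrite /= eqn_leq ij jn.
  by rewrite tperm1 mul1g.
move: ij; rewrite leq_eqVlt => /orP[/eqP/val_inj->|].
  by rewrite tperm1 mul1g.
rewrite jn ltnS => lin.
have nm : n < m by rewrite -ltnS -jn ltnS ltnW.
pose k := Ordinal nm.
have step s' : connect bruhat_edge s' (tperm k j * s')%g.
  by apply: connect1; apply/existsP; exists k; apply/existsP; exists j; rewrite jn !eqxx.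
move: lin; rewrite leq_eqVlt => /orP[/eqP ik|lik].
  by have -> : i = k by apply: val_inj.
have -> : tperm i j = (tperm k j * (tperm i k * tperm k j))%g.
  rewrite -{1}(tpermV k j) -/(conjg _ _) tpermJ tpermL tpermD //.
    by rewrite -val_eqE /= gtn_eqF.
  by rewrite -val_eqE /= gtn_eqF // jn ltnS ltnW.
rewrite -!mulgA; apply: connect_trans (step _).
apply: connect_trans (IHn k (erefl _) (ltnW lik) _).
exact: step.
Qed.

Lemma bruhat_connected s s' : connect bruhat_edge s s'.
Proof.
rewrite -[s'](mulgKV s); have [ts -> _] := prod_tpermP (s' * s^-1)%g.
elim: ts => [|[i j] ts IHts]; first by rewrite big_nil mul1g.
by rewrite big_cons -mulgA (connect_trans IHts) ?bruhat_connect_tperm.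
Qed.

Definition bruhat_graph : connectedGraph :=
  ConnectedGraph bruhat_edge_sym bruhat_edge_irr bruhat_connected.

End Bruhat.

(* Main.v *)
(** The proof is Hurlbert's weight function method.  Let [w] be a weight on the
    vertices, zero at the root, such that every vertex of positive weight is a
    neighbour of the root or has a neighbour of at least twice its weight.
    Starting from an unsolvable configuration [C], moving pebbles towards such
    heavier neighbours never decreases the weight [\sum_v C v * w v], and ends
    with at most one pebble on each vertex of positive weight, so this weight is
    at most [\sum_v w v].  Five such weights on B_4, each carried by a tree
    along which it (at least) doubles towards the root, add up to at least 8 on
    every vertex other than the root and have total weight 561 < 8 * 72; so no
    configuration with 72 pebbles is unsolvable. *)
Require Import Defs.
From mathcomp Require Import all_boot.
From mathcomp Require Import all_fingroup boolp.

Set Implicit Arguments.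
Unset Strict Implicit.
Unset Printing Implicit Defensive.

Section WeightFunction.

Variable G : connectedGraph.

Implicit Types (C : config G) (u v r : G) (w : G -> nat).

Definition strategy r w : Prop :=
  w r = 0 /\
  forall v, 0 < w v -> edge v r \/ exists2 u, edge v u & (w v).*2 <= w u.

(** The loss [(w u).*2] stands on the left so that no truncated subtraction occurs. *)
Lemma weight_move C u v w : 2 <= C u ->
  \sum_x move C u v x * w x + (w u).*2 = \sum_x C x * w x + w v.
Proof.
move=> Cu.
have delta y k : \sum_(x : G) (if x == y then k * w x else 0) = k * w y.
  by rewrite -big_mkcond big_pred1_eq.
rewrite -muln2 mulnC -(delta u 2) -[w v in RHS]mul1n -(delta v 1) -!big_split /=.
apply: eq_bigr => x _; rewrite ffunE mulnDl addnAC; congr (_ + _); last by case: eqP.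
by case: eqP => [->|]; rewrite ?subn0 ?addn0 // -mulnDl subnK.
Qed.

Lemma pebbles_move C u v : 2 <= C u -> pebbles (move C u v) < pebbles C.
Proof.
move=> Cu; have := weight_move v (fun=> 1) Cu.
under eq_bigr do rewrite muln1; under [in RHS]eq_bigr do rewrite muln1.
by rewrite /pebbles addn1 addn2 => -[<-].
Qed.

Lemma solvable_root r C : 0 < C r -> solvable r C.
Proof. by exists [::]. Qed.

Lemma solvable_step r C D : pebbling_step C D -> solvable r D -> solvable r C.
Proof. by move=> CD [s [ps ls]]; exists (D :: s); rewrite /= CD. Qed.

Lemma weight_function r w C :
  strategy r w -> ~ solvable r C -> \sum_v C v * w v <= \sum_v w v.
Proof.
move=> [wr wP]; have [n] := ubnP (pebbles C); elim: n C => // n IHn C leCn unsolv.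
(* If no vertex of positive weight holds two pebbles, the bound holds term by term. *)
have [/existsP[v /andP[wv Cv]]|/existsPn small] :=
    boolP [exists v, (0 < w v) && (2 <= C v)]; last first.
  apply: leq_sum => v _; move: (small v); rewrite negb_and -eqn0Ngt -leqNgt.
  by case/orP => [/eqP-> | Cv]; rewrite ?muln0 // -[leqRHS]mul1n leq_mul2r Cv orbT.
case: (wP v wv) => [vr | [u vu wvu]].
  by case: unsolv; apply: (@solvable_path _ [:: r] v); rewrite /= ?vr.
apply: leq_trans (IHn (move C v u) _ _).
(* The move changes the weight by [w u] minus twice [w v], which is nonnegative. *)
- by rewrite -(leq_add2r (w u)) -(weight_move u w Cv) leq_add2l.
- exact: leq_trans (pebbles_move u Cv) leCn.
- by move/(solvable_step (pebbling_stepT vu Cv)).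
Qed.

Lemma weight_bound r t k (I : finType) (w : I -> G -> nat) :
    (forall i, strategy r (w i)) ->
    (forall v, v != r -> k <= \sum_i w i v) ->
    \sum_i \sum_v w i v < k * t ->
  all_solvable r t.
Proof.
move=> wP kw wt C Ct; apply: contrapT => unsolv; move: wt; rewrite ltnNge => /negP; apply.
(* The root is empty, so [k] need not bound the weights there. *)
have Cr : C r = 0 by have [//|/solvable_root] := posnP (C r).
rewrite -Ct mulnC big_distrl /=.
apply: (@leq_trans (\sum_i \sum_v C v * w i v)); last first.
  by apply: leq_sum => i _; apply: weight_function (wP i) unsolv.
rewrite exchange_big /=; apply: leq_sum => v _; rewrite -big_distrr /=.
by have [->|/kw kwv] := eqVneq v r; rewrite ?Cr // leq_mul2l kwv orbT.
Qed.

Lemma pebbling_number_le t :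
  (forall r, all_solvable r t) -> pebbling_number G <= t.
Proof.
move=> solv; apply/bigmax_leqP => r _; rewrite /rooted_pebbling_number.
by case: ex_minnP => n _; apply; apply/asboolP.
Qed.

End WeightFunction.

Section Words.

Variable m : nat.

Implicit Types s : 'S_m.

(** Words make conditions on permutations decidable by plain computation on lists. *)
Definition word s : seq nat := [seq val (s i) | i : 'I_m].

Lemma size_word s : size (word s) = m.
Proof. by rewrite size_image card_ord. Qed.

Lemma nth_word s (i : 'I_m) : nth 0 (word s) i = s i.
Proof.
by rewrite (nth_map i) ?nth_ord_enum // size_enum_ord.
Qed.

Lemma word_inj : injective word.
Proof. by move=> s t st; apply/permP => i; apply: val_inj; rewrite /= -!nth_word st. Qed.

Lemma word1 : word 1%g = iota 0 m.
Proof. by rewrite -val_enum_ord; apply: eq_map => i; rewrite perm1. Qed.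

Lemma mem_word s : word s \in permutations (iota 0 m).
Proof.
rewrite mem_permutations uniq_perm ?iota_uniq //.
  by rewrite map_inj_uniq ?enum_uniq // => i j /val_inj/perm_inj.
move=> k; rewrite mem_iota add0n; apply/imageP/idP => [[i _ ->]|km]; first exact: ltn_ord.
by exists (s^-1 (Ordinal km))%g; rewrite ?permKV.
Qed.

Lemma sum_word (F : seq nat -> nat) :
  \sum_(s : 'S_m) F (word s) = \sum_(a <- permutations (iota 0 m)) F a.
Proof.
rewrite -(big_map word predT F); apply: perm_big.
have uw : uniq (map word (index_enum _)).
  by rewrite map_inj_uniq ?index_enum_uniq //; apply: word_inj.
apply: uniq_perm; rewrite ?permutations_uniq //.
(* Both lists are duplicate-free and have m! entries, so one inclusion suffices. *)
have [|| _ //] := uniq_min_size uw (s2 := permutations (iota 0 m)).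
  by move=> _ /mapP[s _ ->]; apply: mem_word.
by rewrite size_permutations ?iota_uniq // size_iota size_map -card_Sn cardT enumT.
Qed.

Definition swap (k : nat) (a : seq nat) : seq nat :=
  mkseq (fun i => nth 0 a (if i == k then k.+1 else if i == k.+1 then k else i)) (size a).

Lemma swap_neighbor s k : k.+1 < m ->
  exists2 t, bruhat_edge s t & word t = swap k (word s).
Proof.
move=> km.
have [i ik] : exists i : 'I_m, i = k :> nat by exists (Ordinal (ltnW km)).
have [j jk] : exists j : 'I_m, j = k.+1 :> nat by exists (Ordinal km).
exists (tperm i j * s)%g.
  by apply/existsP; exists i; apply/existsP; exists j; rewrite jk ik !eqxx.
apply: (@eq_from_nth _ 0) => [|l]; rewrite /swap ?size_mkseq ?size_word // => lm.
have -> : l = Ordinal lm by [].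
move: (Ordinal lm) => {lm}l; rewrite nth_mkseq ?size_word //.
rewrite nth_word permM -nth_word -jk -ik; congr nth; case: (tpermP i j l) => [->|->|/eqP li /eqP lj].
- by rewrite eqxx.
- by rewrite eqxx jk ik gtn_eqF.
- by rewrite !val_eqE (negPf li) (negPf lj).
Qed.

(** Edges multiply on the left, so right translations are automorphisms; they carry weights rooted
    at the identity to any root. *)
Lemma bruhat_edge_mulr r s t : bruhat_edge (s * r)%g (t * r)%g = bruhat_edge s t.
Proof.
by apply: eq_existsb => i; apply: eq_existsb => j; rewrite mulgA (inj_eq (mulIg r)).
Qed.

(** Boolean form of [strategy] at the identity, whose word is [iota 0 m]. *)
Definition is_strategy (f : seq nat -> nat) : bool :=
  (f (iota 0 m) == 0) &&
  all (fun a => (f a == 0) ||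
         has (fun k => (swap k a == iota 0 m) || ((f a).*2 <= f (swap k a))) (iota 0 m.-1))
      (permutations (iota 0 m)).

Lemma bruhat_strategy f (r : bruhat_graph m) :
  is_strategy f -> strategy r (fun v => f (word (v * r^-1)%g)).
Proof.
case/andP => [/eqP f1 /allP fP]; split=> [|v fv]; first by rewrite mulgV word1.
have := fP _ (mem_word (v * r^-1)%g); rewrite eqn0Ngt fv /= => /hasP[k].
rewrite mem_iota add0n => km fk.
have [|t vt tE] := swap_neighbor (v * r^-1)%g (k := k).
  by case: (m) km => // m' /=; rewrite ltnS.
have {vt} : bruhat_edge v (t * r)%g by rewrite -(bruhat_edge_mulr r^-1) mulgK.
move: fk; rewrite -tE -word1 (inj_eq word_inj) => /orP[/eqP-> | ft].
  by rewrite mul1g; left.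
by right; exists (t * r)%g; rewrite ?mulgK.
Qed.

End Words.

(* Found by linear programming over tree weights, scaled by 8 and rounded down
   to integers.  Permutations are words in the letters 0, ..., 3; those not
   listed have weight 0. *)
Definition tree_weights : seq (seq (seq nat * nat)) :=
  [:: [:: ([:: 0; 1; 3; 2], 32); ([:: 0; 3; 1; 2], 16); ([:: 3; 0; 1; 2], 8);
       ([:: 3; 0; 2; 1], 4); ([:: 3; 2; 0; 1], 2); ([:: 2; 3; 0; 1], 1);
       ([:: 3; 2; 1; 0], 1)];
      [:: ([:: 0; 2; 1; 3], 64); ([:: 2; 0; 1; 3], 32); ([:: 2; 0; 3; 1], 16);
       ([:: 2; 3; 0; 1], 8); ([:: 2; 3; 1; 0], 4); ([:: 3; 2; 0; 1], 4);
       ([:: 3; 2; 1; 0], 2); ([:: 3; 1; 2; 0], 1)];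
      [:: ([:: 1; 0; 2; 3], 64); ([:: 1; 0; 3; 2], 32); ([:: 1; 3; 0; 2], 16);
       ([:: 3; 1; 0; 2], 8); ([:: 3; 0; 1; 2], 4); ([:: 3; 1; 2; 0], 4);
       ([:: 3; 2; 1; 0], 2); ([:: 3; 2; 0; 1], 1)];
      [:: ([:: 0; 2; 1; 3], 32); ([:: 0; 2; 3; 1], 16); ([:: 2; 0; 1; 3], 16);
       ([:: 0; 3; 2; 1], 8); ([:: 2; 1; 0; 3], 8); ([:: 3; 0; 2; 1], 4);
       ([:: 2; 1; 3; 0], 4); ([:: 3; 2; 0; 1], 2); ([:: 1; 2; 3; 0], 2);
       ([:: 3; 2; 1; 0], 1); ([:: 1; 3; 2; 0], 1)];
      [:: ([:: 1; 0; 2; 3], 64); ([:: 1; 2; 0; 3], 32); ([:: 1; 2; 3; 0], 16);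
       ([:: 1; 3; 2; 0], 8); ([:: 2; 1; 3; 0], 8); ([:: 3; 1; 2; 0], 4);
       ([:: 2; 3; 1; 0], 4); ([:: 3; 1; 0; 2], 2); ([:: 3; 2; 1; 0], 2);
       ([:: 3; 2; 0; 1], 1)]].

(** An unlisted word gets an index past the end, where [nth] returns 0. *)
Definition weight (t : seq (seq nat * nat)) (a : seq nat) : nat :=
  nth 0 (unzip2 t) (index a (unzip1 t)).

Theorem theorem3p5 : pebbling_number (bruhat_graph 4) <= 72.
Proof.
apply: pebbling_number_le => r.
pose w (i : 'I_5) a := weight (nth [::] tree_weights i) a.
apply: (@weight_bound _ r 72 8 _ (fun i v => w i (word (v * r^-1)%g))).
- move=> i; apply: bruhat_strategy.
  suff /all_nthP : all (fun t => is_strategy 4 (weight t)) tree_weights by apply.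
  by vm_compute.
- move=> v vr.
  have : word (v * r^-1)%g != iota 0 4.
    by rewrite -word1 (inj_eq (@word_inj _)) -(inj_eq (mulIg r)) mulgKV mul1g.
  (* Big operators are locked; [sumn] lets the check over all 24 words compute. *)
  suff /allP/(_ _ (mem_word (v * r^-1)%g))/implyP : all (fun a => (a != iota 0 4) ==>
      (8 <= sumn [seq weight t a | t <- tree_weights])) (permutations (iota 0 4)).
    move=> H /H; rewrite sumnE big_map (big_nth [::]) big_mkord; exact.
  by vm_compute.
- have sum_w i : \sum_(v : bruhat_graph 4) w i (word (v * r^-1)%g) =
                 sumn [seq w i a | a <- permutations (iota 0 4)].
    (* Substituting [s * r] for [v] makes the total independent of the root. *)
    rewrite sumnE big_map -sum_word (reindex_inj (mulIg r)) /=.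
    by apply: eq_bigr => s _; rewrite mulgK.
  under eq_bigr do rewrite sum_w.
  by rewrite !big_ord_recl big_ord0; vm_compute.
Qed.
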